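(* Let $n\ge 3$. If $\Gamma_1\le\Gamma_2$ in the planar tree poset $\mathrm{Pnr}_n$ and the subforest $F(\Gamma_1,\Gamma_2)$ has $k$ edges, then the interval $[\Gamma_1,\Gamma_2]=\{\Gamma : \Gamma_1\le\Gamma\le\Gamma_2\}$ is isomorphic to the Boolean lattice $\mathrm{Bool}_k$ of all subsets of $\{1,\dots,k\}$ ordered by inclusion.
   Context: A tree is a finite, contractible, $1$-dimensional simplicial complex. For $n\ge 3$, a marked $n$-tree is a tree with distinct marked vertices $v_1,\dots,v_n$ such that every vertex of valence $1$ or $2$ is marked. A contraction $f\colon\Gamma_1\to\Gamma_2$ of $n$-trees is a surjective cellular map (up to isotopy within edges) with $f^{-1}(v_i)$ a subtree of $\Gamma_1$ containing $v_i$ for each $i$. Equivalently, it collapses the components of a subforest whose components each contain at most one marked vertex, and such a contraction, when it exists, is unique. For such a contraction, $F(\Gamma_1,\Gamma_2)$ is the unique subforest of $\Gamma_1$ with two properties: its components each contain at most one marked vertex, and contracting them yields $\Gamma_2$. A planar $n$-tree is a free isotopy class of planar embeddings $\phi\colon\Gamma\to\mathbb{C}$ of an $n$-tree $\Gamma$, i.e. an $n$-tree with a cyclic counterclockwise ordering of the edges at each vertex. For planar $n$-trees $\phi_1\colon\Gamma_1\to\mathbb{C}$ and $\phi_2\colon\Gamma_2\to\mathbb{C}$, write $\Gamma_1\le\Gamma_2$ if there is a contraction $f\colon\Gamma_1\to\Gamma_2$ with $\phi_1$ isotopic to $\phi_2\circ f$. This partial order on planar $n$-trees is the planar tree poset $\mathrm{Pnr}_n$.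 *)

(* Defs.v *)
From HB Require Import structures.
From mathcomp Require Import all_boot all_order.
From mathcomp Require Import boolp.

Set Implicit Arguments.
Unset Strict Implicit.
Unset Printing Implicit Defensive.

Import Order.Theory.

(* Trees are only used up to isomorphism, so the vertex set is taken to be
   'I_m for some m; this keeps the type of trees small. *)
Record ntree (n : nat) := NTree {
  nvert : nat;
  adj : rel 'I_nvert;
  mark : 'I_n -> 'I_nvert;
  adj_sym : symmetric adj;
  adj_irr : irreflexive adj;
  (* contractible = connected and without cycles; [:: u; v] with u, v adjacent
     is a ucycle, whence the bound 2 *)
  adj_connected : forall u v, connect adj u v;
  adj_acyclic : forall c, ucycle adj c -> size c <= 2;
  mark_inj : injective mark;
  low_valence_marked :
    forall v, #|[set u | adj v u]| \in [:: 1; 2] -> exists i, mark i = v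
}.

Arguments nvert {n} _.
Arguments adj {n} _.
Arguments mark {n} _.

Notation vertex G := 'I_(nvert G).

Definition edges n (G : ntree n) : {set {set vertex G}} :=
  [set [set p.1; p.2] | p : vertex G * vertex G & adj G p.1 p.2].

(* A contraction, recorded by its action on vertices: an edge is sent either
   to a vertex or homeomorphically onto an edge, and every vertex has a
   connected preimage (for the vertex mark G2 i, a subtree containing
   mark G1 i). *)
Record contraction n (G1 G2 : ntree n) (f : vertex G1 -> vertex G2) : Prop :=
  Contraction {
    contr_vertex_surj : forall w, exists v, f v = w;
    contr_edge_surj : forall w w', adj G2 w w' ->
      exists u v, [/\ adj G1 u v, f u = w & f v = w'];
    contr_cellular : forall u v, adj G1 u v -> f u = f v \/ adj G2 (f u) (f v);
    contr_fiber : forall u v, f u = f v ->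
      connect [rel x y | adj G1 x y && (f x == f y)] u v;
    contr_mark : forall i, f (mark G1 i) = mark G2 i
  }.

Definition forest_rel n (G : ntree n) (F : {set {set vertex G}}) :
  rel (vertex G) := [rel u v | [set u; v] \in F].

(* F = F(G1, G2), a subforest being given by its set of edges. *)
Record contraction_forest n (G1 G2 : ntree n) (F : {set {set vertex G1}}) :
    Prop := ContractionForest {
  cforest_edges : F \subset edges G1;
  cforest_marks : forall i j,
    connect (forest_rel F) (mark G1 i) (mark G1 j) -> i = j;
  cforest_quotient : exists2 f : vertex G1 -> vertex G2, contraction f
    & forall u v, f u = f v <-> connect (forest_rel F) u v
}.

Arguments contraction_forest {n} _ _ _.

(* The edge from v to a is the next one after the edge from v to u, in the
   counterclockwise order at v, when a = rot v u. The values of rot v outside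
   the neighbours of v are irrelevant. *)
Record planar_ntree (n : nat) := PlanarNTree {
  ptree :> ntree n;
  rot : vertex ptree -> vertex ptree -> vertex ptree;
  rot_adj : forall v u, adj ptree v u -> adj ptree v (rot v u);
  rot_cyclic : forall v a b,
    adj ptree v a -> adj ptree v b -> fconnect (rot v) a b
}.

Arguments rot {n} _.

(* Turning counterclockwise around a fibre of f: first_kept f d d' holds when
   d' is the first oriented edge with f d'.1 != f d'.2 met from d onwards. When
   an edge (v, u) inside the fibre is met, the walk goes along it and continues
   with the edge following (u, v) at u. *)
Inductive first_kept n (G : planar_ntree n) (T : eqType) (f : vertex G -> T) :
    vertex G -> vertex G -> vertex G -> vertex G -> Prop :=
| FirstKept v u : f v != f u -> first_kept f v u v u
| FirstKeptStep v u v' u' : f v = f u ->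
    first_kept f u (rot G u v) v' u' -> first_kept f v u v' u'.

(* The cyclic orders of G2 are those induced by the cyclic orders of G1. *)
Definition planar_map n (G1 G2 : planar_ntree n)
    (f : vertex G1 -> vertex G2) : Prop :=
  forall v u, adj G1 v u -> f v != f u ->
  exists v' u', first_kept f v (rot G1 v u) v' u' /\
                rot G2 (f v) (f u) = f u'.

Definition planar_le n (G1 G2 : planar_ntree n) : Prop :=
  exists f : vertex G1 -> vertex G2, contraction f /\ planar_map f.

Definition planar_iso n (G1 G2 : planar_ntree n) : Prop :=
  exists f : vertex G1 -> vertex G2,
    [/\ bijective f,
        forall u v, adj G2 (f u) (f v) = adj G1 u v,
        forall i, f (mark G1 i) = mark G2 i
      & forall v u, adj G1 v u -> rot G2 (f v) (f u) = f (rot G1 v u)].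

Lemma planar_iso_refl n (G : planar_ntree n) : planar_iso G G.
Proof. by exists id; split=> //; exists id. Qed.

Lemma planar_iso_sym n (G H : planar_ntree n) :
  planar_iso G H -> planar_iso H G.
Proof.
case=> f [[g fK gK] fadj fmark frot]; exists g; split.
- by exists f.
- by move=> u v; rewrite -fadj !gK.
- by move=> i; rewrite -fmark fK.
- by move=> v u vu; apply: (can_inj fK); rewrite -frot ?gK // -fadj !gK.
Qed.

Lemma planar_iso_trans n (G H K : planar_ntree n) :
  planar_iso G H -> planar_iso H K -> planar_iso G K.
Proof.
case=> f [fbij fadj fmark frot] [g [gbij gadj gmark grot]].
exists (g \o f); split.
- exact: bij_comp.
- by move=> u v /=; rewrite gadj fadj.
- by move=> i /=; rewrite fmark gmark.
- by move=> v u vu /=; rewrite grot ?fadj // frot.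
Qed.

Lemma planar_iso_le n (G H : planar_ntree n) : planar_iso G H -> planar_le G H.
Proof.
case=> f [[g fK gK] fadj fmark frot]; exists f; split; first split.
- by move=> w; exists (g w).
- by move=> w w' ww'; exists (g w), (g w'); rewrite !gK -fadj !gK.
- by move=> u v uv; right; rewrite fadj.
- by move=> u v /(can_inj fK) ->.
- exact: fmark.
move=> v u vu _; exists v, (rot G v u); split; last exact: frot.
apply: FirstKept; apply/eqP => /(can_inj fK) e.
by have := rot_adj vu; rewrite -e adj_irr.
Qed.

Lemma contraction_comp n (G H K : ntree n) (f : vertex G -> vertex H)
    (g : vertex H -> vertex K) :
  contraction f -> contraction g -> contraction (g \o f).
Proof.
move=> cf cg; split.
- move=> w; have [v <-] := contr_vertex_surj cg w.
  by have [u <-] := contr_vertex_surj cf v; exists u.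
- move=> w w' /(contr_edge_surj cg)[a [b [ab <- <-]]].
  by have [u [v [uv <- <-]]] := contr_edge_surj cf ab; exists u, v.
- move=> u v /= /(contr_cellular cf)[-> | /(contr_cellular cg) //].
  by left.
- have fib u v : f u = f v ->
    connect [rel x y | adj G x y && ((g \o f) x == (g \o f) y)] u v.
    move=> /(contr_fiber cf); apply: connect_sub => x y /= /andP[xy /eqP e].
    by apply: connect1; rewrite /= xy e eqxx.
  move=> u v /= /(contr_fiber cg)/connectP[p]; elim: p u => [|w p IHp] u /=.
    by move=> _ /esym /fib.
  case/andP=> /andP[/(contr_edge_surj cf)[a [b [ab fa fb]]] /eqP e] wp lp.
  apply: connect_trans (fib u a (esym fa)) _.
  apply: (@connect_trans _ _ b); last by apply: IHp; rewrite fb.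
  by apply: connect1; rewrite /= ab fa fb e eqxx.
- by move=> i /=; rewrite (contr_mark cf) (contr_mark cg).
Qed.

Lemma first_kept_ends n (G : planar_ntree n) (T : eqType) (f : vertex G -> T)
    v u v' u' :
  first_kept f v u v' u' -> adj G v u ->
  [/\ f v' = f v, adj G v' u' & f v' != f u'].
Proof.
elim=> {v u v' u'} [v u vu adj_vu|v u v' u' e _ IH vu]; first by [].
by rewrite e; apply: IH; apply: rot_adj; rewrite adj_sym.
Qed.

Lemma planar_map_comp n (G H K : planar_ntree n) (f : vertex G -> vertex H)
    (g : vertex H -> vertex K) :
  contraction f -> planar_map f -> planar_map g -> planar_map (g \o f).
Proof.
move=> cf pf pg.
have cat v u v1 u1 v' u' : first_kept f v u v1 u1 ->
    first_kept (g \o f) v1 u1 v' u' -> first_kept (g \o f) v u v' u'.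
  elim=> // {v u v1 u1} v u v1 u1 e _ IH /IH; apply: FirstKeptStep.
  by rewrite /= e.
have lift a b a' b' : first_kept g a b a' b' -> forall v u v1 u1, adj G v u ->
    first_kept f v u v1 u1 -> a = f v1 -> b = f u1 ->
    exists v' u', [/\ first_kept (g \o f) v u v' u', a' = f v' & b' = f u'].
  elim=> {a b a' b'} [a b ab|a b a' b' e _ IH] v u v1 u1 vu k1 ea eb.
    exists v1, u1; split=> //; apply: cat k1 _; apply: FirstKept.
    by rewrite /= -ea -eb.
  have [_ adj1 kept1] := first_kept_ends k1 vu.
  have adj1' : adj G u1 v1 by rewrite adj_sym.
  have [|v2 [u2 [k2 e2]]] := pf u1 v1 adj1'; first by rewrite eq_sym.
  have [f2 _ _] := first_kept_ends k2 (rot_adj adj1').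
  have [||v' [u' [k' ea' eb']]] := IH _ _ v2 u2 (rot_adj adj1') k2.
  - by rewrite f2.
  - by rewrite -e2 ea eb.
  exists v', u'; split=> //; apply: cat k1 _; apply: FirstKeptStep k'.
  by rewrite /= -ea -eb.
move=> v u vu /= gvu.
have fvu : f v != f u by apply: contraNneq gvu => ->.
have adjf : adj H (f v) (f u).
  by case: (contr_cellular cf vu) => // e; rewrite e eqxx in fvu.
have [v1 [u1 [k1 e1]]] := pf v u vu fvu.
have [a [b [k2 e2]]] := pg _ _ adjf gvu.
have [f1 _ _] := first_kept_ends k1 (rot_adj vu).
have [||v' [u' [k' _ eb]]] := lift _ _ _ _ k2 _ _ v1 u1 (rot_adj vu) k1.
- by rewrite f1.
- by [].
by exists v', u'; split=> //; rewrite e2 eb.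
Qed.

Lemma planar_le_trans n (G H K : planar_ntree n) :
  planar_le G H -> planar_le H K -> planar_le G K.
Proof.
move=> [f [cf pf]] [g [cg pg]]; exists (g \o f); split.
  exact: contraction_comp.
exact: planar_map_comp.
Qed.

Lemma planar_le_nvert n (G H : planar_ntree n) :
  planar_le G H -> nvert H <= nvert G.
Proof.
case=> f [cf _]; rewrite -(card_ord (nvert H)) -[leqRHS]card_ord.
apply: leq_trans (leq_image_card f predT); apply: subset_leq_card.
apply/subsetP=> w _; have [v <-] := contr_vertex_surj cf w.
exact: image_f.
Qed.

Lemma planar_le_anti n (G H : planar_ntree n) :
  planar_le G H -> planar_le H G -> planar_iso G H.
Proof.
move=> leGH /planar_le_nvert leHG.
have eGH : nvert G = nvert H.
  by apply/eqP; rewrite eqn_leq leHG planar_le_nvert.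
case: leGH => f [cf pf].
have finj : injective f.
  apply/injectiveP/card_uniqP; rewrite size_codom card_ord [RHS]eGH.
  rewrite -[RHS]card_ord; apply: eq_card => w; rewrite [RHS]inE.
  by have [v <-] := contr_vertex_surj cf w; apply: codom_f.
have fadj u v : adj H (f u) (f v) = adj G u v.
  apply/idP/idP => [/(contr_edge_surj cf)|/[dup] uv /(contr_cellular cf)].
    by case=> a [b [ab /finj <- /finj <-]].
  by case=> // /finj e; rewrite e adj_irr in uv.
exists f; split=> //; first by apply: inj_card_bij; rewrite // !card_ord eGH.
  exact: contr_mark.
move=> v u vu; have [|v' [u' [k ->]]] := pf _ _ vu.
  by apply: contraTneq vu => /finj ->; rewrite adj_irr.
case: k (rot_adj vu) => // a b a' b' /finj -> _.
by rewrite adj_irr.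
Qed.

Lemma contraction_forest_exists n (G1 G2 : ntree n)
    (f : vertex G1 -> vertex G2) :
  contraction f -> exists F, contraction_forest G1 G2 F.
Proof.
move=> cf.
pose F := [set [set p.1; p.2] | p : vertex G1 * vertex G1
           & adj G1 p.1 p.2 && (f p.1 == f p.2)].
have FE u v : f u = f v <-> connect (forest_rel F) u v.
  split=> [/(contr_fiber cf)|/connectP[p up ->]].
    apply: connect_sub => x y /= xy; apply: connect1; apply/imsetP.
    by exists (x, y); rewrite ?inE.
  elim: p u up => //= w p IHp u /andP[/imsetP[[a b]]].
  rewrite inE /= => /andP[_ /eqP fab] e /IHp <-.
  have fs x : x \in [set u; w] -> f x = f b.
    by rewrite e !inE => /orP[] /eqP ->.
  by rewrite !fs // !inE eqxx ?orbT.
exists F; split; last by exists f.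
  by apply: imsetS; apply/subsetP => p; rewrite !inE => /andP[].
by move=> i j /FE; rewrite !(contr_mark cf) => /mark_inj.
Qed.

HB.instance Definition _ n := gen_eqMixin (planar_ntree n).
HB.instance Definition _ n := gen_choiceMixin (planar_ntree n).

Definition planar_isob n : rel (planar_ntree n) :=
  fun G H => `[< planar_iso G H >].

Lemma planar_isob_equiv n : equiv_class_of (@planar_isob n).
Proof.
split=> [G|G H|G H K]; first by apply/asboolP; apply: planar_iso_refl.
  by apply/asboolP/asboolP; apply: planar_iso_sym.
by move=> /asboolP HG /asboolP GK; apply/asboolP; apply: planar_iso_trans GK.
Qed.

Canonical planar_iso_equiv n := EquivRelPack (planar_isob_equiv n).

(* The planar n-trees proper, as isomorphism classes, and their order. *)
Definition Pnr n := {eq_quot (planar_iso_equiv n)}%qT.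

HB.instance Definition _ n := Choice.on (Pnr n).

Definition pnr n (G : planar_ntree n) : Pnr n := (\pi_{eq_quot _} G)%qT.

Definition pnr_le n : rel (Pnr n) := fun x y =>
  `[< exists G H, [/\ pnr G = x, pnr H = y & planar_le G H] >].

Lemma pnr_eqP n (G H : planar_ntree n) : pnr G = pnr H <-> planar_iso G H.
Proof. by split=> [/eqmodP/asboolP|/asboolP e]; last exact/eqmodP. Qed.

Lemma pnr_leP n (G H : planar_ntree n) :
  pnr_le (pnr G) (pnr H) <-> planar_le G H.
Proof.
split=> [/asboolP[G' [H' [/pnr_eqP GG' /pnr_eqP HH' le']]]|le].
  apply: planar_le_trans (planar_iso_le (planar_iso_sym GG')) _.
  exact: planar_le_trans le' (planar_iso_le HH').
by apply/asboolP; exists G, H.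
Qed.

Lemma pnr_surj n (x : Pnr n) : exists G, pnr G = x.
Proof. by exists (repr x); rewrite /pnr reprK. Qed.

Lemma pnr_le_refl n : reflexive (@pnr_le n).
Proof.
move=> x; have [G <-] := pnr_surj x.
exact/pnr_leP/planar_iso_le/planar_iso_refl.
Qed.

Lemma pnr_le_anti n : antisymmetric (@pnr_le n).
Proof.
move=> x y; have [G <-] := pnr_surj x; have [H <-] := pnr_surj y.
by case/andP=> /pnr_leP GH /pnr_leP HG; apply/pnr_eqP/planar_le_anti.
Qed.

Lemma pnr_le_trans n : transitive (@pnr_le n).
Proof.
move=> y x z; have [G <-] := pnr_surj x; have [H <-] := pnr_surj y.
have [K <-] := pnr_surj z => /pnr_leP GH /pnr_leP HK.
by apply/pnr_leP; apply: planar_le_trans HK.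
Qed.

Fact pnr_display : Order.disp_t. Proof. exact: (Order.Disp tt tt). Qed.

HB.instance Definition _ n := Order.Le_isPOrder.Build pnr_display (Pnr n)
  (@pnr_le_refl n) (@pnr_le_anti n) (@pnr_le_trans n).

(* Main.v *)
Require Import Defs.
From HB Require Import structures.
From mathcomp Require Import all_boot all_order.
From mathcomp Require Import boolp.

(* [rot] must denote the rotation of a planar tree, not [seq.rot]. *)
Import Defs.

Set Implicit Arguments.
Unset Strict Implicit.
Unset Printing Implicit Defensive.

(** A contraction between two n-trees is unique: an unmarked vertex has at
    least three branches, each containing a mark, so it is the median of three
    marks; contractions preserve medians, and medians in a tree are unique.
    Hence a tree [G] above [G1] is given with a definite set of collapsed edges
    of [G1], and [G <= H] implies that this set grows. Conversely, if every edge
    collapsed in [G] is collapsed in [H], the contraction onto [H] factors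
    through [G], and the factor is planar because the walk around a fibre of
    the composite projects to the walk around a fibre of the factor. So the
    interval embeds into the subsets of [F]. Every subset is reached by
    collapsing its edges one at a time; a collapsed edge never joins two marks,
    since its ends are identified in [G2]. *)

(** * Separation in trees and uniqueness of contractions *)

(** The graph with [z] deleted: away from [z], the classes of [connect (off e z)] are the branches
    at [z]. *)
Definition off (T : finType) (e : rel T) (z : T) : rel T :=
  [rel x y | [&& e x y, x != z & y != z]].

Lemma off_sym (T : finType) (e : rel T) z : symmetric e -> symmetric (off e z).
Proof. by move=> es x y; rewrite /off /= es [X in _ && X]andbC. Qed.

Lemma off_connectC (T : finType) (e : rel T) z x y :
  symmetric e -> connect (off e z) x y = connect (off e z) y x.
Proof. by move=> es; apply: sym_connect_sym; apply: off_sym. Qed.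

Lemma off_path_notin (T : finType) (e : rel T) z x p :
  x != z -> path (off e z) x p -> z \notin x :: p.
Proof.
elim: p x => /= [|y p IHp] x xz; first by rewrite inE eq_sym.
by case/andP=> /and3P[_ _ yz] yp; rewrite inE negb_or eq_sym xz; apply: IHp.
Qed.

Lemma off_connect_neq (T : finType) (e : rel T) z x y :
  x != z -> connect (off e z) x y -> y != z.
Proof.
move=> xz /connectP[p /(off_path_notin xz) zN ->].
by apply: contraNneq zN => <-; apply: mem_last.
Qed.

Lemma off_path (T : finType) (e : rel T) z x p :
  path e x p -> z \notin x :: p -> path (off e z) x p.
Proof.
elim: p x => //= y p IHp x /andP[xy yp].
rewrite !inE !negb_or => /and3P[zx zy zp].
rewrite /off /= xy eq_sym zx eq_sym zy /=; apply: IHp => //.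
by rewrite inE negb_or zy.
Qed.

Lemma path_connect_off (T : finType) (e : rel T) z x p :
  path e x p -> z \notin x :: p -> connect (off e z) x (last x p).
Proof. by move=> xp /(off_path xp) zp; apply/connectP; exists p. Qed.

(** A simple path from [a] to [b] avoiding [z] closes up through [z] to a cycle of length at least
    3, unless it is trivial. *)
Lemma acyclic_off_inj (T : finType) (e : rel T) :
    (forall c, ucycle e c -> size c <= 2) -> symmetric e -> irreflexive e ->
  forall z a b, e z a -> e z b -> connect (off e z) a b -> a = b.
Proof.
move=> acyc es ei z a b za zb.
have az : a != z by apply: contraTneq za => ->; rewrite ei.
case/connectP=> p0 p0P bE; rewrite {b}bE in zb *.
case: (shortenP p0P) zb => p ap /= /andP[aN up] _ zb {p0 p0P}.
case: p ap aN up zb => // b p ap aN up zb.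
have zN := off_path_notin az ap.
suff /acyc : ucycle e [:: z, a, b & p] by [].
rewrite /ucycle; apply/andP; split; last by rewrite cons_uniq zN cons_uniq aN.
rewrite (cycle_path z) /= es.
have -> : e z (last b p) by [].
rewrite za /= -[e a b && _]/(path e a (b :: p)).
by apply: sub_path ap => x y /and3P[].
Qed.

(** Converse of [acyclic_off_inj]. Acyclicity of a collapsed tree is proved in this form, since
    connectedness off a vertex can be lifted through a collapse. *)
Lemma off_inj_acyclic (T : finType) (e : rel T) : symmetric e ->
    (forall z a b, e z a -> e z b -> connect (off e z) a b -> a = b) ->
  forall c, ucycle e c -> size c <= 2.
Proof.
move=> es einj [|z [|a [|b p]]] // /andP[].
rewrite /cycle rcons_path => /andP[/= /andP[za ap] lz] /andP[zN uap].
suff aE : a = last b p by case/andP: uap; rewrite aE mem_last.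
apply: (einj z) => //; first by rewrite es.
exact: (@path_connect_off _ e z a (b :: p)).
Qed.

(** Each edge of the path lifts, and consecutive lifts are joined inside a fibre; no fibre used is
    the one over [X]. *)
Lemma lift_connect_off (T T' : finType) (e : rel T) (e' : rel T') (f : T -> T')
    (X : T') :
    (forall w w', e' w w' -> exists u v, [/\ e u v, f u = w & f v = w']) ->
    (forall u v, f u = f v -> connect [rel x y | e x y && (f x == f y)] u v) ->
  forall p q, f p != X -> connect (off e' X) (f p) (f q) ->
  connect [rel x y | [&& e x y, f x != X & f y != X]] p q.
Proof.
move=> edge fib.
have fib' u v : f u != X -> f u = f v ->
    connect [rel x y | [&& e x y, f x != X & f y != X]] u v.
  move=> uX /fib/connectP[s]; elim: s u uX => [|w s IHs] u uX /=.
    by move=> _ ->.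
  case/andP=> /andP[uw /eqP fe] ws lw.
  have wX : f w != X by rewrite -fe.
  by apply: connect_trans (IHs w wX ws lw); apply: connect1; rewrite /= uw uX.
move=> p q pX /connectP[s]; elim: s p pX => [|w s IHs] p pX /=.
  by move=> _ /esym; apply: fib'.
case/andP=> /and3P[/edge[u [v [uv fu fv]]] _ wX] ws lw.
apply: connect_trans (fib' p u pX (esym fu)) _.
apply: (@connect_trans _ _ v); last by apply: IHs; rewrite fv.
by apply: connect1; rewrite /= uv fu fv pX.
Qed.

Lemma tree_off_inj n (G : ntree n) (z a b : vertex G) :
  adj G z a -> adj G z b -> connect (off (adj G) z) a b -> a = b.
Proof.
apply: acyclic_off_inj; [exact: adj_acyclic|exact: adj_sym|exact: adj_irr].
Qed.

Lemma adj_neq n (G : ntree n) (u v : vertex G) : adj G u v -> u != v.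
Proof. by apply: contraTneq => ->; rewrite adj_irr. Qed.

Definition marked n (G : ntree n) (v : vertex G) := exists i, mark G i = v.

Lemma valence_gt0 n (G : ntree n) (u v : vertex G) :
  u != v -> 0 < #|[set w | adj G v w]|.
Proof.
move=> uv; case/connectP: (adj_connected v u) => [[|w p] /=].
  by move=> _ e; rewrite e eqxx in uv.
by case/andP=> vw _ _; apply/card_gt0P; exists w; rewrite inE.
Qed.

Lemma unmarked_valence n (G : ntree n) (v : vertex G) : 0 < n ->
  ~ marked v -> 2 < #|[set u | adj G v u]|.
Proof.
move=> n0 vN; have : mark G (Ordinal n0) != v.
  by apply/eqP => e; apply: vN; exists (Ordinal n0).
move/valence_gt0; have := @low_valence_marked _ G v.
by case: #|_| => [|[|[|m]]] // /(_ isT).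
Qed.

(** Induction on the size of the branch: an unmarked [z] has a neighbour [w] other than [v], and the
    branch of [w] at [z] is a proper part of the branch of [z] at [v]. *)
Lemma branch_marked n (G : ntree n) (v z : vertex G) : 0 < n -> adj G v z ->
  exists i, connect (off (adj G) v) z (mark G i).
Proof.
move=> n0; have [m] := ubnP #|[set x | connect (off (adj G) v) z x]|.
elim: m v z => // m IHm v z; rewrite ltnS => lem vz.
have [[i <-]|zN] := EM (marked z); first by exists i.
have zv : adj G z v by rewrite adj_sym.
have : 1 < #|[set u | adj G z u]| := ltnW (unmarked_valence n0 zN).
rewrite (cardsD1 v) inE zv ltnS => /card_gt0P[w]; rewrite !inE => /andP[wv zw].
have wz : w != z by rewrite eq_sym; apply: adj_neq.
have vNw : ~~ connect (off (adj G) z) w v.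
  by apply: contraNN wv => /(tree_off_inj zw zv) ->.
have sub x : connect (off (adj G) z) w x -> connect (off (adj G) v) w x.
  case/connectP=> p wp ->; apply: path_connect_off.
    by apply: sub_path wp => ? ? /and3P[].
  apply: contraNN vNw => /(path_connect wp) //.
have step : connect (off (adj G) v) z w.
  by apply: connect1; rewrite /off /= zw eq_sym (adj_neq vz) wv.
have [|i wi] := IHm z w _ zw.
  apply: leq_trans lem; apply: proper_card; apply/properP; split.
    apply/subsetP=> x; rewrite !inE => /sub; exact: connect_trans.
  exists z; rewrite inE ?connect0 //; apply/negP => /(off_connect_neq wz).
  by rewrite eqxx.
by exists i; apply: connect_trans step (sub _ wi).
Qed.

(** The cases [p = v] and [q = v] are included because a contraction may send [p] or [q] to the
    image of [v]. *)
Definition separates n (G : ntree n) (v p q : vertex G) : Prop :=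
  [\/ p = v, q = v | ~~ connect (off (adj G) v) p q].

(** A path downstairs avoiding [f v] lifts to one avoiding the whole fibre of [f v], in particular
    [v]. *)
Lemma separates_contraction n (G H : ntree n) (f : vertex G -> vertex H) v p q :
  contraction f -> separates v p q -> separates (f v) (f p) (f q).
Proof.
move=> cf sep; case: (eqVneq (f p) (f v)) => [|pv]; first by constructor 1.
case: (eqVneq (f q) (f v)) => [|qv]; first by constructor 2.
constructor 3; apply/negP => /(lift_connect_off (contr_edge_surj cf)
  (contr_fiber cf) pv) c.
case: sep => [e|e|/negP[]]; [by rewrite e eqxx in pv|by rewrite e eqxx in qv|].
apply: connect_sub c => x y /and3P[xy xv yv]; apply: connect1.
rewrite /off /= xy /=; apply/andP;
  split; [apply: contraNneq xv|apply: contraNneq yv].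
  by move=> ->.
by move=> ->.
Qed.

Definition median n (G : ntree n) (v p q r : vertex G) : Prop :=
  [/\ separates v p q, separates v p r & separates v q r].

(** A simple path from [p] to [x] that met [y] would do so before [x], and its initial part would
    join [p] to [y] off [x]. *)
Lemma off_connect_swap n (G : ntree n) (x y p : vertex G) : x != y ->
  p = x \/ ~~ connect (off (adj G) x) p y -> connect (off (adj G) y) p x.
Proof.
move=> xy [->//|pN].
case/connectP: (adj_connected p x) => s0 s0P xE.
case: (shortenP s0P) xE => s ps us _ xE {s0 s0P}.
suff yN : y \notin p :: s by rewrite xE; apply: path_connect_off.
apply: contraNN pN => ys.
case/splitPl: ys ps us xE => s1 s2 s1y.
rewrite cat_path last_cat s1y -cat_cons cat_uniq => /andP[ps1 ys2].
case/and3P=> _ /hasPn s12 _ xE; apply/connectP; exists s1 => //.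
apply: off_path => //; apply: s12; rewrite xE.
by move: xy; rewrite xE; case: (s2) => [|a b] /=; rewrite ?eqxx // mem_last.
Qed.

(* If [y != x], the vertex [x] separates [p], [q], [r] pairwise, so at most one
   of them lies on the side of [y], and the two others meet at [x] away
   from [y]. *)
Lemma median_unique n (G : ntree n) (x y p q r : vertex G) :
  median x p q r -> median y p q r -> x = y.
Proof.
move=> [xpq xpr xqr] [ypq ypr yqr].
apply: contrapT => /eqP xy.
pose away w := w = x \/ ~~ connect (off (adj G) x) w y.
have sym := @off_connectC _ (adj G) _ _ _ (@adj_sym _ G).
have two s t : away s -> away t -> separates y s t -> False.
  move=> /(off_connect_swap xy) sx /(off_connect_swap xy) tx.
  have neq w : connect (off (adj G) y) w x -> w <> y.
    by rewrite sym => /(off_connect_neq xy)/eqP.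
  case=> [/neq|/neq|/negP[]]; try by apply.
  by apply: connect_trans sx _; rewrite sym.
have one s t : separates x s t -> away s \/ away t.
  case=> [->|->|st]; [by left; left|by right; left|].
  have [sy|] := boolP (connect (off (adj G) x) s y); last by left; right.
  right; right; apply: contraNN st => ty; apply: connect_trans sy _.
  by rewrite sym.
case: (one _ _ xpq) => [ap|aq].
  case: (one _ _ xqr) => [aq|ar]; first exact: two ap aq ypq.
  exact: two ap ar ypr.
case: (one _ _ xpr) => [ap|ar]; first exact: two ap aq ypq.
exact: two aq ar yqr.
Qed.

Lemma unmarked_median n (G : ntree n) (v : vertex G) : 0 < n -> ~ marked v ->
  exists i j k, median v (mark G i) (mark G j) (mark G k).
Proof.
move=> n0 vN; have := unmarked_valence n0 vN.
case/card_gt2P=> a [b [c [[]]]]; rewrite !inE => va vb vc [ab bc ca].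
have [i ai] := branch_marked n0 va.
have [j bj] := branch_marked n0 vb.
have [k ck] := branch_marked n0 vc.
have sym := @off_connectC _ (adj G) _ _ _ (@adj_sym _ G).
have sep s t l m : adj G v s -> adj G v t -> s != t ->
    connect (off (adj G) v) s (mark G l) ->
    connect (off (adj G) v) t (mark G m) ->
    ~~ connect (off (adj G) v) (mark G l) (mark G m).
  move=> vs vt st sl tm; apply: contraNN st => lm; apply/eqP.
  apply: tree_off_inj vs vt _; apply: connect_trans sl _.
  by apply: connect_trans lm _; rewrite sym.
have ij := sep _ _ _ _ va vb ab ai bj.
have jk := sep _ _ _ _ vb vc bc bj ck.
have ik : ~~ connect (off (adj G) v) (mark G i) (mark G k).
  by apply: sep va vc _ ai ck; rewrite eq_sym.
by exists i, j, k; split; constructor 3.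
Qed.

Lemma contraction_unique n (G H : ntree n) (f g : vertex G -> vertex H) :
  0 < n -> contraction f -> contraction g -> f =1 g.
Proof.
move=> n0 cf cg v; have [[i <-]|vN] := EM (marked v).
  by rewrite (contr_mark cf) (contr_mark cg).
have [i [j [k [vij vik vjk]]]] := unmarked_median n0 vN.
have med h : contraction h ->
    median (h v) (mark H i) (mark H j) (mark H k).
  by move=> ch; rewrite -!(contr_mark ch); split; apply: separates_contraction.
exact: median_unique (med f cf) (med g cg).
Qed.

(** * Factorization of planar contractions *)

Lemma fiber_path n (G : ntree n) (T : eqType) (f : vertex G -> T) u v :
    connect [rel x y | adj G x y && (f x == f y)] u v ->
  exists p, [/\ path (adj G) u p, last u p = v, uniq (u :: p)
    & {in u :: p, forall w, f w = f u}].
Proof.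
case/connectP=> p0 p0P ->; case: (shortenP p0P) => p up uniqp _ {p0 p0P}.
exists p; split=> //; first by apply: sub_path up => x y /andP[].
elim: p u up {uniqp} => [|w p IHp] u /=; first by move=> _ x /[!inE] /eqP ->.
case/andP=> /andP[_ /eqP fu] /IHp fw x.
by rewrite inE => /orP[/eqP -> //|/fw ->].
Qed.

(** At most one edge joins two given fibres: two such edges and the paths joining their ends inside
    the fibres form a cycle, of length at most 2, so both paths are trivial. *)
Lemma kept_edge_inj n (G : ntree n) (T : eqType) (f : vertex G -> T) u v a b :
    (forall x y, f x = f y ->
       connect [rel x y | adj G x y && (f x == f y)] x y) ->
    adj G u v -> adj G a b -> f u = f a -> f v = f b -> f u != f v ->
  u = a /\ v = b.
Proof.
move=> fib uv ab /fib/fiber_path[p [up pa upu fp]].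
move=> /esym/fib/fiber_path[q [bq qv uqb fq]] fuv.
have /adj_acyclic : ucycle (adj G) ((u :: p) ++ (b :: q)).
  apply/andP; split.
    rewrite (cycle_path u) last_cat /= qv adj_sym uv cat_path up pa /=.
    by rewrite ab.
  rewrite cat_uniq upu uqb andbT; apply/hasPn => x xq; apply/negP => xp.
  have vq : v \in b :: q by rewrite -qv mem_last.
  by move: fuv; rewrite -(fp _ xp) (fq _ xq) (fq _ vq) eqxx.
rewrite size_cat /= addnS ltnS; case: p q {up upu fp bq uqb fq} pa qv => [|? ?].
  by case=> //= -> ->.
by [].
Qed.

Lemma kept_adj n (G H : ntree n) (f : vertex G -> vertex H) u v :
  contraction f -> adj G u v -> f u != f v -> adj H (f u) (f v).
Proof. by move=> cf /(contr_cellular cf)[->|//]; rewrite eqxx. Qed.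

Lemma first_kept_det n (G : planar_ntree n) (T : eqType) (f : vertex G -> T)
    v u v1 u1 v2 u2 :
  first_kept f v u v1 u1 -> first_kept f v u v2 u2 -> v1 = v2 /\ u1 = u2.
Proof.
move=> k; elim: k v2 u2 => {v u v1 u1} [v u vu|v u v' u' e _ IH] v2 u2 k.
  by case: k vu => // {}v {}u ? ? ->; rewrite eqxx.
by case: k e IH => [{}v {}u /eqP //|{}v {}u ? ? _ k _]; apply.
Qed.

Lemma first_kept_stop n (G : planar_ntree n) (T : eqType) (f : vertex G -> T)
    v u v' u' :
  first_kept f v u v' u' -> f v != f u -> v' = v /\ u' = u.
Proof. by move=> k kept; apply: first_kept_det k (FirstKept kept). Qed.

(** Induction on the walk for [g \o f]. A step along an edge collapsed by [f] does not move the
    image; a step along an edge kept by [f] but collapsed by [g] becomes one step of the walk for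
    [g], planarity of [f] identifying the edge that follows in [H]. *)
Lemma first_kept_push n (G H : planar_ntree n) (T : eqType)
    (f : vertex G -> vertex H) (g : vertex H -> T) v u v' u' v1 u1 :
    planar_map f -> first_kept (g \o f) v u v' u' -> adj G v u ->
  first_kept f v u v1 u1 -> first_kept g (f v1) (f u1) (f v') (f u').
Proof.
move=> pf k; elim: k v1 u1 => {v u v' u'} [v u gvu|v u v' u' e _ IH] v1 u1.
  move=> vu k1.
  have [|-> ->] := first_kept_stop k1; last exact: FirstKept.
  by apply: contraNneq gvu => /= ->.
move=> vu; have uv : adj G u v by rewrite adj_sym.
have [fvu|fvu] := eqVneq (f v) (f u).
  move=> k1; apply: IH; first exact: rot_adj.
  by case: k1 fvu => [? ? /eqP //|].
move=> /first_kept_stop/(_ fvu)[-> ->].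
have [|v2 [u2 [k2 e2]]] := pf u v uv; first by rewrite eq_sym.
apply: FirstKeptStep; [exact: e|rewrite e2].
have [<- _ _] := first_kept_ends k2 (rot_adj uv).
by apply: IH k2; apply: rot_adj.
Qed.

Lemma contraction_factor n (G H K : ntree n) (f : vertex G -> vertex H)
    (h : vertex G -> vertex K) (g : vertex H -> vertex K) :
  contraction f -> contraction h -> h =1 g \o f -> contraction g.
Proof.
move=> cf ch hE; split.
- by move=> w; have [v <-] := contr_vertex_surj ch w; exists (f v); rewrite hE.
- move=> w w' /[dup] /adj_neq ww' /(contr_edge_surj ch)[u [v [uv]]].
  rewrite !hE /= => gu gv; exists (f u), (f v); split=> //.
  by apply: kept_adj uv _ => //;
  apply: contraNneq ww' => fe; rewrite -gu -gv fe.
- move=> x y /(contr_edge_surj cf)[u [v [uv <- <-]]].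
  by have := contr_cellular ch uv; rewrite !hE.
- move=> x y; have [u <-] := contr_vertex_surj cf x.
  have [v <-] := contr_vertex_surj cf y.
  rewrite -[g (f u)]/((g \o f) u) -[g (f v)]/((g \o f) v) -!hE.
  case/(contr_fiber ch)/connectP=> p.
  elim: p u => [|w p IHp] u /=; first by move=> _ ->.
  case/andP=> /andP[uw /eqP]; rewrite !hE /= => ge wp lp.
  have [-> //|fuw] := eqVneq (f u) (f w); first exact: IHp.
  apply: connect_trans (IHp w wp lp); apply: connect1.
  by rewrite /= ge eqxx andbT; apply: kept_adj.
- by move=> i; rewrite -(contr_mark cf) -(contr_mark ch) hE.
Qed.

Lemma planar_map_factor n (G H K : planar_ntree n) (f : vertex G -> vertex H)
    (h : vertex G -> vertex K) (g : vertex H -> vertex K) :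
    contraction f -> planar_map f -> planar_map h -> h =1 g \o f ->
  planar_map g.
Proof.
move=> cf pf ph /funext hE; rewrite {h}hE in ph.
move=> x y /(contr_edge_surj cf)[v [u [vu <- <-]]] gvu.
have [//|v' [u' [k e]]] := ph v u vu.
have [|v1 [u1 [k1 ->]]] := pf v u vu; first by apply: contraNneq gvu => ->.
exists (f v'), (f u'); split=> //.
have [<- _ _] := first_kept_ends k1 (rot_adj vu).
exact: first_kept_push k (rot_adj vu) k1.
Qed.

Lemma collapse_factor n (G H K : ntree n) (f : vertex G -> vertex H)
    (h : vertex G -> vertex K) : contraction f ->
    (forall u v, adj G u v -> f u = f v -> h u = h v) ->
  exists g : vertex H -> vertex K, h =1 g \o f.
Proof.
move=> cf fh; have [s sK] := choice (contr_vertex_surj cf).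
(* Any section [s] will do: [h] is constant on the fibres of [f], which are connected. *)
exists (h \o s) => v /=.
case/connectP: (contr_fiber cf (esym (sK (f v)))) => p.
elim: p v => [|w p IHp] v /=; first by move=> _ ->.
case/andP=> /andP[vw /eqP fe] wp; rewrite (fh _ _ vw fe) fe; exact: IHp.
Qed.

Lemma planar_factor n (G H K : planar_ntree n) (f : vertex G -> vertex H)
    (h : vertex G -> vertex K) :
    contraction f -> planar_map f -> contraction h -> planar_map h ->
    (forall u v, adj G u v -> f u = f v -> h u = h v) ->
  exists g : vertex H -> vertex K,
    [/\ contraction g, planar_map g & h =1 g \o f].
Proof.
move=> cf pf ch ph /(collapse_factor cf)[g hE]; exists g; split=> //.
  exact: contraction_factor hE.
exact: planar_map_factor hE.
Qed.

(** * Collapsing one edge *)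

Section FiberWalk.
Variables (n : nat) (G : planar_ntree n) (T : finType) (f : vertex G -> T).

(* The boundary walk of the fibres of [f], on oriented edges; [first_kept]
   follows it up to the next kept edge. *)
Definition fiber_step (d : vertex G * vertex G) : vertex G * vertex G :=
  if f d.1 == f d.2 then (d.2, rot G d.2 d.1) else (d.1, rot G d.1 d.2).

Lemma fiber_step_adj d : adj G d.1 d.2 ->
  adj G (fiber_step d).1 (fiber_step d).2 /\ f (fiber_step d).1 = f d.1.
Proof.
rewrite /fiber_step => vu; case: eqVneq => [->|_] /=; split=> //.
  by apply: rot_adj; rewrite adj_sym.
exact: rot_adj.
Qed.

(** [first_kept] has no solution when the walk meets only collapsed edges; a single kept edge ahead
    ensures one. *)
Lemma walk_first_kept d d' : fconnect fiber_step d d' -> f d'.1 != f d'.2 ->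
  exists v u, first_kept f d.1 d.2 v u.
Proof.
case/connectP=> p + -> kept {d'}.
elim: p d kept => [|e p IHp] d /= kept.
  by move=> _; exists d.1, d.2; apply: FirstKept.
case/andP=> /eqP; rewrite /fiber_step; case: eqVneq => [ed|kd] de ep.
  have [v [u k]] := IHp e kept ep; exists v, u.
  by apply: FirstKeptStep => //; move: k; rewrite -de.
by exists d.1, d.2; apply: FirstKept.
Qed.

(** Each passage of the walk from one kept edge to the next is one application of [r], so the walk
    around a fibre projects to an orbit of [r]. This is how the induced rotation is shown to be
    cyclic. *)
Lemma walk_fconnect (r : T -> T) x d d' :
    (forall v u v' u', adj G v u -> f v = x -> f v != f u ->
       first_kept f v (rot G v u) v' u' -> r (f u) = f u') ->
    adj G d.1 d.2 -> f d.1 = x -> f d'.1 != f d'.2 ->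
    fconnect fiber_step d d' ->
  exists v u, first_kept f d.1 d.2 v u /\ fconnect r (f u) (f d'.2).
Proof.
move=> rE + + kept /connectP[p + eq_d'].
rewrite {}eq_d' in kept *; elim: p d kept => [|e p IHp] d /= kept vu fx.
  by move=> _; exists d.1, d.2; split; [apply: FirstKept|].
have := fiber_step_adj vu; rewrite fx => -[vu' fx'].
case/andP=> /eqP de ep; rewrite de in vu' fx'.
have [v [u [k c]]] := IHp e kept vu' fx' ep.
move: de; rewrite /fiber_step; case: eqVneq => [ed|kd] de.
  exists v, u; split=> //.
  by apply: FirstKeptStep => //; move: k; rewrite -de.
exists d.1, d.2; split; first exact: FirstKept.
apply: connect_trans c; rewrite -(rE d.1 d.2 v u) // ?fconnect1 //.
by move: k; rewrite -de.
Qed.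

End FiberWalk.

Section EdgeCollapse.
Variables (n : nat) (G : planar_ntree n) (a b : vertex G).
Variables (m : nat) (f : vertex G -> 'I_m).
Hypotheses (n_gt0 : 0 < n) (ab : adj G a b).
Hypothesis f_surj : forall w, exists v, f v = w.
Hypothesis fE :
  forall x y, f x = f y <-> [\/ x = y, x = a /\ y = b | x = b /\ y = a].
Hypothesis ab_marks : forall i j, mark G i = a -> mark G j = b -> False.

Lemma collapse_fiber x y : f x = f y ->
  connect [rel u v | adj G u v && (f u == f v)] x y.
Proof.
move=> fe; have [->//|xy] := eqVneq x y.
apply: connect1; rewrite /= fe eqxx andbT.
case/fE: fe => [e|[-> ->]|[-> ->]] //; last by rewrite adj_sym.
by rewrite e eqxx in xy.
Qed.

Lemma collapse_other x y z : f x = f y -> x != y -> f x = f z -> x != z ->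
  y = z.
Proof.
move=> /fE[-> /eqP//|[-> ->]|[-> ->]] _ /fE[-> /eqP//|[e ->]|[e ->]] // _.
Qed.

Definition collapse_adj : rel 'I_m := fun x y =>
  (x != y) && [exists v, exists u, [&& adj G v u, f v == x & f u == y]].

Lemma collapse_adjP x y : reflect
  (x != y /\ exists v u, [/\ adj G v u, f v = x & f u = y]) (collapse_adj x y).
Proof.
apply: (iffP andP) => -[xy].
  case/existsP=> v /existsP[u /and3P[vu /eqP vx /eqP uy]].
  by split=> //; exists v, u.
case=> v [u [vu vx uy]]; split=> //; apply/existsP; exists v.
by apply/existsP; exists u; rewrite vu vx uy !eqxx.
Qed.

Lemma collapse_adjT v u : adj G v u -> f v != f u -> collapse_adj (f v) (f u).
Proof. by move=> vu fvu; apply/collapse_adjP; split=> //; exists v, u. Qed.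

Lemma collapse_sym : symmetric collapse_adj.
Proof.
have sub x y : collapse_adj x y -> collapse_adj y x.
  case/collapse_adjP=> xy [v [u [vu vx uy]]]; apply/collapse_adjP.
  by rewrite eq_sym; split=> //; exists u, v; rewrite adj_sym.
by move=> x y; apply/idP/idP; apply: sub.
Qed.

Lemma collapse_irr : irreflexive collapse_adj.
Proof. by move=> x; rewrite /collapse_adj eqxx. Qed.

Lemma collapse_connected x y : connect collapse_adj x y.
Proof.
have [u <-] := f_surj x; have [v <-] := f_surj y.
case/connectP: (adj_connected u v) => p + ->.
elim: p u => [|w p IHp] u //= /andP[uw /IHp].
have [-> //|fuw] := eqVneq (f u) (f w).
by apply: connect_trans; apply: connect1; apply: collapse_adjT.
Qed.

Lemma collapse_acyclic c : ucycle collapse_adj c -> size c <= 2.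
Proof.
apply: off_inj_acyclic collapse_sym _ c => x y1 y2.
case/collapse_adjP=> xy1 [v1 [u1 [vu1 fv1 fu1]]].
case/collapse_adjP=> xy2 [v2 [u2 [vu2 fv2 fu2]]].
rewrite -fu1 -fu2.
have u1x : f u1 != x by rewrite fu1 eq_sym.
have u2x : f u2 != x by rewrite fu2 eq_sym.
have edge w w' : collapse_adj w w' ->
    exists u v, [/\ adj G u v, f u = w & f v = w'] by case/collapse_adjP.
move/(lift_connect_off edge collapse_fiber u1x) => c.
have {}c : connect (off (adj G) v1) u1 u2.
  apply: connect_sub c => p q /and3P[pq px qx]; apply: connect1.
  rewrite /off /= pq /=; apply/andP.
  by split; [apply: contraNneq px|apply: contraNneq qx] => ->; rewrite fv1.
have [e|v12] := eqVneq v1 v2.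
  by rewrite -e in vu2; rewrite (tree_off_inj vu1 vu2 c).
have av : adj G v1 v2.
  case/fE: (etrans fv1 (esym fv2)) => [e|[-> ->]|[-> ->]] //.
    by rewrite e eqxx in v12.
  by rewrite adj_sym.
(* Here [v1] and [v2] are the two ends of the collapsed edge. The lifted path, prolonged by the edge
   from [u2] to [v2], joins the neighbours [u1] and [v2] of [v1] off [v1]. *)
suff u1E : u1 = v2 by rewrite -fu1 u1E fv2 eqxx in xy1.
apply: tree_off_inj vu1 av _; apply: connect_trans c _; apply: connect1.
rewrite /off /= adj_sym vu2 [v2 == _]eq_sym v12 andbT /=.
by apply: contraNneq u2x => ->; rewrite fv1.
Qed.

Lemma collapse_mark_inj : injective (f \o mark G).
Proof.
move=> i j /= /fE[/mark_inj //|[ia jb]|[ib ja]].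
  by case: (ab_marks ia jb).
by case: (ab_marks ja ib).
Qed.

(** [f] is injective on the neighbours of [v]: if both [a] and [b] were among them, there would be a
    triangle. *)
Lemma collapse_valence_other v : v != a -> v != b ->
  #|[set y | collapse_adj (f v) y]| = #|[set u | adj G v u]|.
Proof.
move=> va vb; rewrite -(card_in_imset (f := f)) => [|u w].
  apply: eq_card => y; rewrite inE; apply/collapse_adjP/imsetP.
    case=> vy [v' [u [vu fv fu]]]; exists u => //; rewrite inE.
    case/fE: fv => [<- //|[_ e]|[_ e]]; first by rewrite e eqxx in vb.
    by rewrite e eqxx in va.
  case=> u; rewrite inE => vu ->; split; last by exists v, u.
  apply/eqP => /fE[e|[e _]|[e _]].
  - by rewrite e adj_irr in vu.
  - by rewrite e eqxx in va.
  - by rewrite e eqxx in vb.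
rewrite !inE => vu vw /fE[//|e|e]; apply: (tree_off_inj vu vw).
  case: e vu vw => -> -> *; apply: connect1.
  by rewrite /off /= ab ![_ == v]eq_sym va vb.
case: e vu vw => -> -> *; apply: connect1.
by rewrite /off /= adj_sym ab ![_ == v]eq_sym va vb.
Qed.

(** The 2 accounts for the two ends of the collapsed edge. The other neighbours of [a] and of [b]
    are disjoint, as there is no triangle, and [f] is injective on their union. *)
Lemma collapse_valence_merged x : f a = x ->
  #|[set u | adj G a u]| + #|[set u | adj G b u]| <=
  #|[set y | collapse_adj x y]|.+2.
Proof.
move=> <-; have ba : adj G b a by rewrite adj_sym.
have fab : f a = f b by apply/fE; constructor 2.
have nab := adj_neq ab.
rewrite (cardsD1 b) (cardsD1 a [set u | adj G b u]) !inE ab ba /= !add1n.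
rewrite addSn addnS !ltnS -cardsUI.
set A := _ :\ b; set B := _ :\ a.
have -> : A :&: B = set0.
  apply/setP => w; rewrite !inE; apply/negP => /and3P[/andP[wb aw] wa bw].
  case/eqP: wb; apply: (tree_off_inj aw ab); apply: connect1.
  by rewrite /off /= adj_sym bw wa eq_sym.
rewrite cards0 addn0 -(card_in_imset (f := f)) => [|u w].
  apply: subset_leq_card; apply/subsetP => y /imsetP[u].
  rewrite !inE => uAB ->; apply/collapse_adjP; case/orP: uAB => /andP[une vu].
    split; last by exists a, u.
    apply/eqP => /fE[e|[_ e]|[e _]]; first by rewrite e adj_irr in vu.
      by rewrite e eqxx in une.
    by rewrite e eqxx in nab.
  split; last by exists b, u; rewrite -fab.
  rewrite fab; apply/eqP => /fE[e|[e _]|[_ e]].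
  - by rewrite e adj_irr in vu.
  - by rewrite e eqxx in nab.
  - by rewrite e eqxx in une.
have neqs v : v \in A :|: B -> v != a /\ v != b.
  rewrite !inE => /orP[] /andP[vne vadj]; split=> //; rewrite eq_sym;
  exact: adj_neq vadj.
move=> /neqs[ua ub] /neqs[wa wb] /fE[//|[e _]|[e _]].
  by rewrite e eqxx in ua.
by rewrite e eqxx in ub.
Qed.

(** If neither end of the collapsed edge is marked, both have valence at least 3, and the merged
    vertex has valence at least 3 + 3 - 2 = 4. *)
Lemma collapse_low_valence_marked x :
  #|[set y | collapse_adj x y]| \in [:: 1; 2] ->
  exists i, (f \o mark G) i = x.
Proof.
have [v <-] := f_surj x => low.
have fab : f a = f b by apply/fE; constructor 2.
have [va|va] := EM (f v = f a).
  have [[i ia]|aN] := EM (marked a); first by exists i; rewrite /= ia.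
  have [[i ib]|bN] := EM (marked b); first by exists i; rewrite /= ib va.
  have := collapse_valence_merged (esym va).
  move/(leq_trans (leq_add (unmarked_valence n_gt0 aN)
    (unmarked_valence n_gt0 bN))).
  by move: low; rewrite !inE => /orP[] /eqP ->.
move: low; rewrite collapse_valence_other.
- by move/low_valence_marked=> [i iv]; exists i; rewrite /= iv.
- by apply/eqP => e; apply: va; rewrite e.
- by apply/eqP => e; apply: va; rewrite e -fab.
Qed.

(** If the edge to [u] is collapsed, the walk crosses it, turns once around [u], crosses back and
    goes on at [v]. The turn around [u] meets no other collapsed edge, a fibre having at most two
    vertices. *)
Lemma collapse_walk_rot v u : adj G v u ->
  fconnect (fiber_step f) (v, u) (v, rot G v u).
Proof.
move=> vu; have uv : adj G u v by rewrite adj_sym.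
have [fvu|fvu] := eqVneq (f v) (f u); last first.
  by apply: connect1; rewrite /= /fiber_step /= (negPf fvu).
apply: (@connect_trans _ _ (u, rot G u v)).
  by apply: connect1; rewrite /= /fiber_step /= fvu eqxx.
apply: (@connect_trans _ _ (u, v)); last first.
  by apply: connect1; rewrite /= /fiber_step /= fvu eqxx.
case/connectP: (rot_cyclic (rot_adj uv) uv) => p.
elim: p (rot G u v) (rot_adj uv) => [|w p IHp] z uz /=; first by move=> _ ->.
case/andP=> /eqP zw wp lp; have [<- //|vz] := eqVneq v z.
have uw : adj G u w by rewrite -zw; apply: rot_adj.
apply: connect_trans (IHp w uw wp lp); apply: connect1.
rewrite /= /fiber_step /= -zw; case: (eqVneq (f u)) => fuz; last exact: eqxx.
case/eqP: vz; apply: (collapse_other (esym fvu) _ fuz); exact: adj_neq.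
Qed.

(** The walk around a fibre is a single cycle: it runs through all edges at one vertex, and it
    passes from one end of the collapsed edge to the other. *)
Lemma collapse_walk v u v' u' : adj G v u -> adj G v' u' -> f v = f v' ->
  fconnect (fiber_step f) (v, u) (v', u').
Proof.
have same x y z : adj G x y -> adj G x z ->
    fconnect (fiber_step f) (x, y) (x, z).
  move=> xy xz; case/connectP: (rot_cyclic xy xz) => p.
  elim: p y xy => [|w p IHp] y xy /=; first by move=> _ ->.
  case/andP=> /eqP yw wp lp; apply: connect_trans (collapse_walk_rot xy) _.
  by rewrite yw; apply: IHp => //; rewrite -yw; apply: rot_adj.
move=> vu vu' fvv'; have [e|vv'] := eqVneq v v'.
  by rewrite e in vu *; apply: same.
have av : adj G v v'.
  case/fE: (fvv') => [e|[-> ->]|[-> ->]] //; first by rewrite e eqxx in vv'.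
  by rewrite adj_sym.
have av' : adj G v' v by rewrite adj_sym.
apply: connect_trans (same _ _ _ vu av) _.
apply: connect_trans (same _ _ _ (rot_adj av') vu').
by apply: connect1; rewrite /= /fiber_step /= fvv' eqxx.
Qed.

Lemma collapse_rot_exists : exists r : 'I_m -> 'I_m -> 'I_m,
  forall v u, adj G v u -> f v != f u ->
  exists v' u', first_kept f v (rot G v u) v' u' /\ r (f v) (f u) = f u'.
Proof.
pose P (xy : 'I_m * 'I_m) z := forall v u, adj G v u -> f v != f u ->
  f v = xy.1 -> f u = xy.2 ->
  exists v' u', first_kept f v (rot G v u) v' u' /\ z = f u'.
suff /choice[r rP] : forall xy, exists z, P xy z.
  by exists (fun x y => r (x, y)) => v u vu fvu; apply: rP.
move=> [x y]; rewrite /P /=.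
have [[v [u [vu [fvu [fx fy]]]]]|no] := EM (exists v u,
  adj G v u /\ f v != f u /\ f v = x /\ f u = y).
(* The walk returns to [(v, u)], which is kept, so a first kept edge exists. *)
- have [v' [u' k]] : exists v' u', first_kept f v (rot G v u) v' u'.
    apply: (@walk_first_kept _ _ _ f (v, rot G v u) (v, u)) => //.
    by apply: collapse_walk => //; apply: rot_adj.
  exists (f u') => v1 u1 vu1 fvu1 fx1 fy1; exists v', u'; split=> //.
  (* The value is independent of the chosen lift, because the edge [(v, u)] is determined by its
     image. *)
  have [||-> -> //] := kept_edge_inj collapse_fiber vu1 vu _ _ fvu1.
    by rewrite fx fx1.
  by rewrite fy fy1.
(* No edge lies over [(x, y)]: [x] is an arbitrary default. *)
- by exists x => v u vu fvu fx fy; case: no; exists v, u.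
Qed.

Lemma edge_collapse_exists : exists (H : planar_ntree n)
  (g : vertex G -> vertex H), [/\ contraction g, planar_map g
  & forall x y, g x = g y <-> [\/ x = y, x = a /\ y = b | x = b /\ y = a]].
Proof.
have [r rP] := collapse_rot_exists.
pose H0 := NTree collapse_sym collapse_irr collapse_connected collapse_acyclic
  collapse_mark_inj collapse_low_valence_marked.
have radj x y : adj H0 x y -> adj H0 x (r x y).
  case/collapse_adjP=> xy [v [u [vu fv fu]]].
  have [|v' [u' [k re]]] := rP v u vu; first by rewrite fv fu.
  have [fv' vu' kept] := first_kept_ends k (rot_adj vu).
  by rewrite -fv -fu re -fv'; apply: collapse_adjT.
have rcyc x y z : adj H0 x y -> adj H0 x z -> fconnect (r x) y z.
  case/collapse_adjP=> xy [v [u [vu fv fu]]].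
  case/collapse_adjP=> xz [v' [u' [vu' fv' fu']]].
  have c : fconnect (fiber_step f) (v, u) (v', u').
    by apply: collapse_walk => //; rewrite fv.
  have rE v0 u0 v1 u1 : adj G v0 u0 -> f v0 = x -> f v0 != f u0 ->
      first_kept f v0 (rot G v0 u0) v1 u1 -> r x (f u0) = f u1.
    move=> vu0 fx0 fvu0 k; have [v2 [u2 [k2 re]]] := rP _ _ vu0 fvu0.
    by rewrite -fx0 re; have [_ ->] := first_kept_det k k2.
  have [|v1 [u1 [k]]] := @walk_fconnect _ _ _ f _ x (v, u) _ rE vu fv _ c.
    by rewrite fv' fu'.
  have [|_ ->] := first_kept_stop k; first by rewrite /= fv fu.
  by rewrite fu fu'.
exists (PlanarNTree radj rcyc), f; split; last exact: fE.
  split=> //.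
  - by move=> w w' /collapse_adjP[].
  - move=> u v uv; have [|fuv] := eqVneq (f u) (f v); first by left.
    by right; apply: collapse_adjT.
  - exact: collapse_fiber.
exact: rP.
Qed.

End EdgeCollapse.

Lemma edge_collapse n (G : planar_ntree n) (a b : vertex G) :
    0 < n -> adj G a b ->
    (forall i j, mark G i = a -> mark G j = b -> False) ->
  exists (H : planar_ntree n) (f : vertex G -> vertex H),
    [/\ contraction f, planar_map f
      & forall x y, f x = f y <-> [\/ x = y, x = a /\ y = b | x = b /\ y = a]].
Proof.
move=> n0 ab marks; have nba : b != a by rewrite eq_sym adj_neq.
have [a' aE _] := unlift_some nba.
(* The vertices other than [b] are renumbered by [unlift b]; the default sends [b] to the new number
   [a'] of [a]. *)
pose f v := odflt a' (unlift b v).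
have fl w : f (lift b w) = w by rewrite /f liftK.
have fa : f a = a' by rewrite aE fl.
have fb : f b = a' by rewrite /f unlift_none.
apply: (edge_collapse_exists (f := f)) => //.
  by move=> w; exists (lift b w).
move=> x y; split; last by case=> [->|[-> ->]|[-> ->]] //; rewrite fa fb.
case: (unliftP b x) => [x' ->|->]; case: (unliftP b y) => [y' ->|->];
  rewrite ?fl ?fb.
- by move=> ->; constructor 1.
- by move=> ->; constructor 2; rewrite -aE.
- by move=> <-; constructor 3; rewrite -aE.
- by constructor 1.
Qed.

(** * Collapsing a subforest *)

Lemma edgesP n (G : ntree n) (e : {set vertex G}) :
  reflect (exists u v, adj G u v /\ e = [set u; v]) (e \in edges G).
Proof.
apply: (iffP imsetP) => [[[u v]]|[u [v [uv ->]]]].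
  by rewrite inE /= => uv ->; exists u, v.
by exists (u, v); rewrite ?inE.
Qed.

Lemma set2_eq (T : finType) (a b u v : T) :
  [set a; b] = [set u; v] -> a = u /\ b = v \/ a = v /\ b = u.
Proof.
move=> e; have : a \in [set u; v] by rewrite -e !inE eqxx.
have : b \in [set u; v] by rewrite -e !inE eqxx orbT.
have : v \in [set a; b] by rewrite e !inE eqxx orbT.
have : u \in [set a; b] by rewrite e !inE eqxx.
by rewrite !inE => /orP[] /eqP ? /orP[] /eqP ? /orP[] /eqP ? /orP[] /eqP ?;
  subst; auto.
Qed.

(** A simple path in [F] between the ends of the edge, if longer than the edge itself, would close
    up with it to a cycle. *)
Lemma forest_edge n (G : ntree n) (F : {set {set vertex G}}) u v :
    F \subset edges G -> adj G u v -> connect (forest_rel F) u v ->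
  [set u; v] \in F.
Proof.
move=> /subsetP FE uv /connectP[p0 p0P vE]; rewrite {v}vE in uv *.
have adjF x y : forest_rel F x y -> adj G x y.
  move=> /FE/edgesP[a [b [ab]]].
  by case/set2_eq => -[-> ->] //; rewrite adj_sym.
case: (shortenP p0P) uv => p up uniqp _ uv {p0 p0P}.
case: p up uniqp uv => [|w [|w2 p]] up uniqp uv.
- by rewrite /= adj_irr in uv.
- by move: up; rewrite /= andbT.
suff /adj_acyclic : ucycle (adj G) [:: u, w, w2 & p] by [].
rewrite /ucycle uniqp andbT (cycle_path u) [last _ _]/(last u (w :: w2 :: p)).
rewrite [path _ _ _]/(_ && path (adj G) u (w :: w2 :: p)) adj_sym uv.
exact: sub_path up.
Qed.

Definition collapses n (G H : ntree n) (f : vertex G -> vertex H)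
    (e : {set vertex G}) : bool :=
  [forall u in e, forall v in e, f u == f v].

Lemma collapses2 n (G H : ntree n) (f : vertex G -> vertex H) u v :
  collapses f [set u; v] <-> f u = f v.
Proof.
split=> [/forall_inP/(_ u)|fuv].
  by rewrite !inE eqxx => /(_ isT)/forall_inP/(_ v); rewrite !inE eqxx orbT
    => /(_ isT)/eqP.
apply/forall_inP => x; rewrite !inE => xE; apply/forall_inP => y.
by rewrite !inE => yE; case/orP: xE yE => /eqP -> /orP[] /eqP ->;
  rewrite ?fuv.
Qed.

(** Induction on the size of [S]. The third clause makes [f2] factor through every stage, which
    keeps two marks from sitting at the ends of the next edge to be collapsed. *)
Lemma collapse_forest n (G1 G2 : planar_ntree n) (F : {set {set vertex G1}})
    (f2 : vertex G1 -> vertex G2) (S : {set {set vertex G1}}) :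
    0 < n -> contraction f2 -> planar_map f2 -> F \subset edges G1 ->
    {in F, forall e, collapses f2 e} -> S \subset F ->
  exists (G : planar_ntree n) (f : vertex G1 -> vertex G),
    [/\ contraction f, planar_map f,
        forall u v, adj G1 u v -> f u = f v -> f2 u = f2 v
      & {in F, forall e, collapses f e = (e \in S)}].
Proof.
move=> n0 cf2 pf2 /subsetP FE Ff2.
have [m] := ubnP #|S|; elim: m S => // m IHm S.
have [->|[e0 e0S]] := set_0Vmem S => [_ _|Sm SF].
  exists G1, id; split.
  - split=> //; [by move=> w; exists w| |by right|by move=> u v ->].
    by move=> w w'; exists w, w'.
  - move=> v u vu _; exists v, (rot G1 v u); split=> //.
    by apply: FirstKept; apply: adj_neq; apply: rot_adj.
  - by move=> u v _ ->.
  - move=> e /FE/edgesP[u [v [uv ->]]]; rewrite inE; apply/negP.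
    move/collapses2=> /= e1; by rewrite e1 adj_irr in uv.
have e0F := subsetP SF _ e0S.
have /edgesP[a0 [b0 [ab0 e0E]]] := FE _ e0F.
have [||G [f [cf pf ff2 fF]]] := IHm (S :\ e0).
- by move: Sm; rewrite (cardsD1 e0 S) e0S.
- exact: subset_trans (subD1set _ _) SF.
have fab : f a0 != f b0.
  by apply/eqP => /collapses2; rewrite -e0E fF // !inE eqxx.
have [g [cg pg gE]] := planar_factor cf pf cf2 pf2 ff2.
have gab : g (f a0) = g (f b0).
  by have := Ff2 _ e0F; rewrite e0E => /collapses2; rewrite !gE.
have marks i j : mark G i = f a0 -> mark G j = f b0 -> False.
  move=> ia jb; have : mark G2 i = mark G2 j.
    by rewrite -!(contr_mark cg) ia jb.
  move/mark_inj=> e; case/eqP: fab; by rewrite -ia -jb e.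
have [H [q [cq pq qE]]] := edge_collapse n0 (kept_adj cf ab0 fab) marks.
exists H, (q \o f); split.
- exact: contraction_comp.
- exact: planar_map_comp.
- move=> u v uv /= /qE [|[fu fv]|[fu fv]]; first exact: ff2.
    by rewrite !gE /= fu fv.
  by rewrite !gE /= fu fv.
move=> e eF; have /edgesP[u [v [uv eE]]] := FE _ eF.
have fib := contr_fiber cf.
apply/idP/idP => [|eS].
  (* Either [f] already collapses [e], or [e] lies over the edge collapsed by [q]; then [e] is [e0],
     only one edge joining these two fibres. *)
  rewrite {1}eE => /collapses2 /= /qE [fuv|[fu fv]|[fu fv]].
  - have : collapses f e by rewrite eE; apply/collapses2.
    by rewrite fF // !inE => /andP[].
  - have [|ua vb] := kept_edge_inj fib uv ab0 fu fv; first by rewrite fu fv.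
    by rewrite eE ua vb -e0E.
  - have ba0 : adj G1 b0 a0 by rewrite adj_sym.
    have [|ua vb] := kept_edge_inj fib uv ba0 fu fv.
      by rewrite fu fv eq_sym.
    by rewrite eE ua vb setUC -e0E.
have [ee0|ne] := eqVneq e e0.
  by rewrite ee0 e0E; apply/collapses2 => /=; apply/qE; constructor 2.
have : collapses f e by rewrite fF // !inE ne.
by rewrite eE => /collapses2 fuv; apply/collapses2; rewrite /= fuv.
Qed.

(** * The interval as a Boolean lattice *)

Theorem theorem2p9 (n : nat) (hn : 3 <= n) (G1 G2 : planar_ntree n)
    (F : {set {set vertex G1}}) (k : nat) :
  (pnr G1 <= pnr G2)%O ->
  contraction_forest G1 G2 F ->
  #|F| = k ->
  exists phi : {G : Pnr n | (pnr G1 <= G <= pnr G2)%O} -> {set 'I_k},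
    bijective phi /\
    forall x y, (sval x <= sval y)%O = (phi x \subset phi y).
Proof.
move=> /pnr_leP[f2 [cf2 pf2]] [FE _ [f2' cf2' f2'E]] <-.
have n0 : 0 < n by apply: leq_trans hn.
(* The contraction coming with [F] and the planar contraction coming with the order agree by
   uniqueness. *)
have f2E u v : f2 u = f2 v <-> connect (forest_rel F) u v.
  by rewrite !(contraction_unique n0 cf2 cf2'); apply: f2'E.
have Ff2 : {in F, forall e, collapses f2 e}.
  move=> e eF; have /edgesP[u [v [uv eE]]] := subsetP FE _ eF.
  by rewrite eE; apply/collapses2/f2E; apply: connect1;
  rewrite /forest_rel /= -eE.
pose I := {G : Pnr n | (pnr G1 <= G <= pnr G2)%O}.
have /choice[GG GGE] : forall x : I, exists G, pnr G = sval x.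
  by move=> x; apply: pnr_surj.
have /all_sig[ff ffP] : forall x : I, {f : vertex G1 -> vertex (GG x) |
    contraction f /\ planar_map f}.
  move=> x; apply: cid; have /andP[le1 _] := svalP x.
  by move: le1; rewrite -GGE => /pnr_leP.
have ff2 x u v : ff x u = ff x v -> f2 u = f2 v.
  have /andP[_] := svalP x; rewrite -GGE => /pnr_leP[g [cg _]].
  have [cx _] := ffP x.
  have e := contraction_unique n0 (contraction_comp cx cg) cf2.
  by move=> xuv; rewrite -!e /= xuv.
pose phi (x : I) := [set i : 'I_#|F| | collapses (ff x) (enum_val i)].
have leE (x y : I) : (sval x <= sval y)%O = (phi x \subset phi y).
  have [[cx px] [cy py]] := (ffP x, ffP y).
  rewrite -!GGE; apply/idP/subsetP => [/pnr_leP[g [cg _]] i|sub].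
    have e := contraction_unique n0 (contraction_comp cx cg) cy.
    rewrite !inE; have /edgesP[u [v [uv ->]]] := subsetP FE _ (enum_valP i).
    by move=> /collapses2 xuv; apply/collapses2; rewrite -!e /= xuv.
  have [|g [cg pg _]] := planar_factor cx px cy py; last first.
    by apply/pnr_leP; exists g.
  move=> u v uv xuv.
  (* Every edge collapsed in [x] is collapsed in [G2], hence belongs to [F], where [sub] applies. *)
  have uvF : [set u; v] \in F.
    by apply: forest_edge => //; apply/f2E; apply: ff2 xuv.
  have := sub (enum_rank_in uvF [set u; v]).
  rewrite !inE enum_rankK_in // => /(_ _)/collapses2; apply.
  exact/collapses2.
have phi_inj : injective phi.
  by move=> x y e; apply/val_inj/Order.POrderTheory.le_anti;
  rewrite !leE e !subxx.
have /choice[psi psiK] : forall S : {set 'I_#|F|}, exists x, phi x = S.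
  move=> S; pose S' := [set enum_val i | i in S].
  have S'F : S' \subset F.
    by apply/subsetP => e /imsetP[i _ ->]; apply: enum_valP.
  have [G [f [cf pf ff2' fF]]] := collapse_forest n0 cf2 pf2 FE Ff2 S'F.
  have [g [cg pg _]] := planar_factor cf pf cf2 pf2 ff2'.
  have GI : (pnr G1 <= pnr G <= pnr G2)%O.
    by apply/andP; split; apply/pnr_leP; [exists f|exists g].
  pose x : I := exist _ (pnr G) GI.
  have [cx px] := ffP x.
  (* The tree [G] built from [S] and the representative [GG x] of its class are isomorphic; by
     uniqueness the isomorphisms, in both directions, commute with the contractions from [G1], so
     the same edges are collapsed. *)
  have /pnr_eqP/planar_iso_le[h [ch _]] : pnr G = pnr (GG x) by rewrite GGE.
  have /pnr_eqP/planar_iso_le[h' [ch' _]] : pnr (GG x) = pnr G by rewrite GGE.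
  have e := contraction_unique n0 (contraction_comp cf ch) cx.
  have e' := contraction_unique n0 (contraction_comp cx ch') cf.
  exists x; apply/setP => i; rewrite inE.
  have -> : (i \in S) = (enum_val i \in S').
    by rewrite mem_imset //; apply: enum_val_inj.
  rewrite -fF ?enum_valP //.
  have /edgesP[u [v [uv ->]]] := subsetP FE _ (enum_valP i).
  apply/idP/idP => /collapses2 uvE; apply/collapses2.
    by rewrite -!e' /= uvE.
  by rewrite -!e /= uvE.
exists phi; split=> //; exists psi => // x; exact: phi_inj.
Qed.
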